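(* Let $n\geq 3$, let $\bm{C}$ be an $n\times n$ row stochastic, zero-diagonal, irreducible matrix whose associated digraph does not have star topology, and let $\bm{c}\in\mathrm{int}(\Delta^{n-1})$ be its Perron-Frobenius left eigenvector (normalized so that $\bm{1}^{\top}\bm{c}=1$). Let $\bm{x}^{*}\in\mathrm{int}(\Delta^{n-1})$ be the non-autocratic fixed point of the DeGroot-Friedkin map $\bm{f}$ with parameter $\bm{c}$, i.e. the fixed point of $\bm{f}$ other than the simplex vertices $\bm{e}_1,\dots,\bm{e}_n$. Let $h>0$ and $$\phi(\bm{x})=\frac{1}{h}\left[D_{\mathrm{KL}}(\bm{x}\parallel\bm{c})+H(\bm{1}-\bm{x})+n-2\right].$$ Then $$\bm{x}^{*}=\underset{\bm{x}\in\Delta^{n-1}\setminus\{\bm{e}_{1},\dots,\bm{e}_{n}\}}{\arg\min}\ \phi(\bm{x})=\underset{\bm{x}\in\Delta^{n-1}\setminus\{\bm{e}_{1},\dots,\bm{e}_{n}\}}{\arg\min}\ \left\{D_{\mathrm{KL}}(\bm{x}\parallel\bm{c})+H(\bm{1}-\bm{x})\right\}.$$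
   Context: $\Delta^{n-1}=\{\bm{x}\in\mathbb{R}^n_{\geq 0}\mid \bm{1}^{\top}\bm{x}=1\}$ is the standard simplex, with vertices the standard basis vectors $\bm{e}_1,\dots,\bm{e}_n$ of $\mathbb{R}^n$; $\mathrm{int}(\Delta^{n-1})=\{\bm{x}\in\mathbb{R}^n_{>0}\mid \bm{1}^{\top}\bm{x}=1\}$; $\bm{1}$ is the all-ones vector. For vectors with nonnegative entries, $H(\bm{p})=-\sum_{i=1}^n p_i\log p_i$ and $D_{\mathrm{KL}}(\bm{p}\parallel\bm{q})=\sum_{i=1}^n p_i\log(p_i/q_i)$, with the convention $0\log 0=0$; in particular $H(\bm{1}-\bm{x})=-\sum_{i=1}^n(1-x_i)\log(1-x_i)$ for $\bm{x}\in\Delta^{n-1}$. The digraph associated with an $n\times n$ nonnegative matrix has vertices $1,\dots,n$ and a directed edge from $i$ to $j$ whenever the $(i,j)$ entry is positive; the matrix is irreducible if this digraph is strongly connected. An $n$-vertex digraph has star topology if there is a node $i$ (the center node) such that every directed edge of the digraph has $i$ as one of its two endpoints. The DeGroot-Friedkin map with parameter $\bm{c}\in\mathrm{int}(\Delta^{n-1})$ is $\bm{f}:\Delta^{n-1}\to\Delta^{n-1}$ given by $\bm{f}(\bm{e}_i)=\bm{e}_i$ for $i=1,\dots,n$, and for $\bm{x}\in\Delta^{n-1}\setminus\{\bm{e}_1,\dots,\bm{e}_n\}$, $$\bm{f}(\bm{x})=\frac{\bm{c}\oslash(\bm{1}-\bm{x})}{\bm{1}^{\top}(\bm{c}\oslash(\bm{1}-\bm{x}))},$$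 where $\oslash$ is element-wise division. It is known that, under the stated assumptions on $\bm{C}$, $\bm{f}$ has exactly one fixed point other than $\bm{e}_1,\dots,\bm{e}_n$, and that this fixed point lies in $\mathrm{int}(\Delta^{n-1})$; it is called the non-autocratic fixed point. *)

(* Defs.v *)
From HB Require Import structures.
From mathcomp Require Import all_boot all_order all_algebra.
From mathcomp Require Import boolp classical_sets reals exp.

Set Implicit Arguments.
Unset Strict Implicit.
Unset Printing Implicit Defensive.

Import Order.TTheory GRing.Theory Num.Theory.
Local Open Scope classical_set_scope.
Local Open Scope ring_scope.

(* Vectors of R^n are row vectors, so that [v *m A] is the left action of a
   matrix on a vector and a left eigenvector is an eigenvector for [*m]. *)

Section Simplex.
Variables (R : realType) (n : nat).
Implicit Types (x y p q : 'rV[R]_n).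

Definition simplex : set 'rV[R]_n :=
  [set x | (forall i, 0 <= x 0 i) /\ \sum_i x 0 i = 1].

Definition int_simplex : set 'rV[R]_n :=
  [set x | (forall i, 0 < x 0 i) /\ \sum_i x 0 i = 1].

Definition vertices : set 'rV[R]_n := range (fun i : 'I_n => delta_mx 0 i).

Definition all_ones : 'rV[R]_n := const_mx 1.

Definition oslash x y : 'rV[R]_n := \row_i (x 0 i / y 0 i).

(* A term with [p 0 i = 0] is [0 * ln _ = 0], the convention 0 log 0 = 0. *)
Definition entropy p : R := - \sum_i p 0 i * ln (p 0 i).

Definition KL p q : R := \sum_i p 0 i * ln (p 0 i / q 0 i).

End Simplex.

Arguments simplex : clear implicits.
Arguments int_simplex : clear implicits.
Arguments vertices : clear implicits.
Arguments all_ones : clear implicits.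

Section Matrices.
Variables (R : realType) (n : nat).
Implicit Types (A : 'M[R]_n).

Definition row_stochastic A : Prop :=
  (forall i j, 0 <= A i j) /\ (forall i, \sum_j A i j = 1).

Definition zero_diagonal A : Prop := forall i, A i i = 0.

Definition digraph A : rel 'I_n := fun i j => 0 < A i j.

Definition irreducible A : Prop := forall i j, connect (digraph A) i j.

Definition star_topology (e : rel 'I_n) : Prop :=
  exists i, forall j k, e j k -> j = i \/ k = i.

(* The Perron-Frobenius eigenvalue of a row stochastic matrix is 1; the
   normalization by the sum of the entries is part of [int_simplex]. *)
Definition stochastic_PF_left_eigenvector A (c : 'rV[R]_n) : Prop :=
  int_simplex R n c /\ c *m A = c.

End Matrices.

Section DeGrootFriedkin.
Variables (R : realType) (n : nat).
Implicit Types (c x : 'rV[R]_n).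

(* Only meaningful on [simplex R n]: there, a point that is not a vertex has
   all its entries smaller than 1, so no division by zero occurs. *)
Definition DF_map c x : 'rV[R]_n :=
  let y := oslash c (all_ones R n - x) in
  if x \in vertices R n then x else (\sum_i y 0 i)^-1 *: y.

Definition non_autocratic_fixed_point c x : Prop :=
  (simplex R n `\` vertices R n) x /\ DF_map c x = x.

Definition DF_potential (h : R) c x : R :=
  h^-1 * (KL x c + entropy (all_ones R n - x) + n%:R - 2).

End DeGrootFriedkin.

Definition argmin (R : realType) (T : Type) (D : set T) (f : T -> R) : set T :=
  [set x | D x /\ forall y, D y -> f x <= f y].

(* Main.v *)
Require Import Defs.
From HB Require Import structures.
From mathcomp Require Import all_boot all_order all_algebra.
From mathcomp Require Import ring lra.
From mathcomp Require Import boolp classical_sets reals exp.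

Set Implicit Arguments.
Unset Strict Implicit.
Unset Printing Implicit Defensive.

Import Order.TTheory GRing.Theory Num.Theory.
Local Open Scope classical_set_scope.
Local Open Scope ring_scope.

(** The fixed-point equation at the non-autocratic point [s] says that [c] is
    proportional to [s * (1 - s)] entrywise.  Substituting this into the
    objective and using that the entries of [x] sum to [1], the objective
    equals, up to a constant that does not depend on [x]
    ([objective_as_divergence_gap]),
      [D(x || s) - D(1 - x || 1 - s) = \sum_i dgap (x i) (s i)],
    where [dgap a p = a ln (a / p) - (1 - a) ln ((1 - a) / (1 - p))].  This sum
    vanishes at [x = s], so everything amounts to its being positive elsewhere.

    Two properties of [dgap] give this.  It is odd under complementation,
    [dgap (1 - a) (1 - p) = - dgap a p], and it is subadditive,
      [dgap (a + b) (p + q) <= dgap a p + dgap b q],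
    strictly unless [a = p] and [b = q] ([dgap_subadd_defect]).  Given two
    indices [i] and [j], merge all the other ones by subadditivity; by oddness
    their contribution is at least [- dgap (x i + x j) (s i + s j)], so the
    whole sum is at least the defect of subadditivity at [i] and [j].  It is
    thus nonnegative, and zero only if [x i = s i]; strictness requires
    [s i + s j < 1], which is where at least three indices are used.

    Subadditivity is by oddness the case of three points [(a, b, t)] and
    [(p, q, r)] of the two-dimensional simplex.  There, writing each [1 - a] as
    [b + t] regroups the gap into three logarithms with weights [a], [b], [t],
    and bounding each by [ln u <= u - 1] leaves a rational function, which is a
    nonnegative combination of the squares of [a - p], [b - q] and [t - r]. *)

(** * The divergence gap and its subadditivity *)

Section DivergenceGap.
Variable R : realType.
Implicit Types a b p q t : R.

Definition dgap a p : R := a * ln (a / p) - (1 - a) * ln ((1 - a) / (1 - p)).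

Lemma dgap_compl a p : dgap (1 - a) (1 - p) = - dgap a p.
Proof. by rewrite /dgap !subKr opprB. Qed.

Lemma dgap00 : dgap 0 0 = 0.
Proof. by rewrite /dgap subr0 divr1 ln1 mul0r mulr0 subr0. Qed.

Lemma dgap_refl p : 0 < p < 1 -> dgap p p = 0.
Proof.
move=> /andP[p0 p1]; rewrite /dgap !divff ?ln1 ?mulr0 ?subrr//.
  by rewrite subr_eq0 gt_eqF.
by rewrite gt_eqF.
Qed.

(** The inequality [ln u <= u - 1] at [u = p * b * t / a], multiplied by [a];
    the degenerate weight [a = 0] survives because [0 <= p * b * t]. *)
Lemma weighted_ln_le a p b t : 0 <= a -> 0 < p -> 0 <= b -> 0 <= t ->
  (0 < a -> 0 < b /\ 0 < t) ->
  a * (ln b + ln t - ln (a / p)) <= p * (b * t) - a.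
Proof.
move=> a0 p0 b0 t0; have [<- _|a_gt0] := eqVneq 0 a.
  by rewrite mul0r subr0 !mulr_ge0// ltW.
have {a_gt0}a0 : 0 < a by rewrite lt_def eq_sym a_gt0.
move=> /(_ a0)[{}b0 {}t0].
have ap0 : 0 < a / p by rewrite divr_gt0.
rewrite -lnM ?posrE// -ln_div ?posrE// ?mulr_gt0//.
have -> : p * (b * t) - a = a * (b * t / (a / p) - 1).
  by field; rewrite !gt_eqF.
have u0 : 0 < b * t / (a / p) by rewrite divr_gt0// mulr_gt0.
rewrite ler_pM2l// -[X in ln X](subrK 1) [X in ln X]addrC le_ln1Dx//.
by rewrite ltrBrDr addNr.
Qed.

(** The defect of subadditivity dominates a positive definite quadratic form
    in the three deviations; positivity of the three weights gives the
    equality case. *)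
Lemma dgap_subadd_defect a b p q : 0 <= a -> 0 <= b -> a + b <= 1 ->
    0 < p -> 0 < q -> p + q < 1 ->
  (q * (1 - (p + q)) * (a - p) ^+ 2 + p * (1 - (p + q)) * (b - q) ^+ 2
     + p * q * (a + b - (p + q)) ^+ 2) / ((1 - p) * (1 - q) * (p + q))
  <= dgap a p + dgap b q - dgap (a + b) (p + q).
Proof.
move=> a0 b0 ab p0 q0 pq.
pose t := 1 - (a + b); pose r := 1 - (p + q).
have t0 : 0 <= t by rewrite /t; lra.
have r0 : 0 < r by rewrite /r; lra.
have p1 : 0 < 1 - p by lra.
have q1 : 0 < 1 - q by lra.
have pq0 : 0 < p + q by lra.
pose A := (1 - a) / (1 - p); pose B := (1 - b) / (1 - q).
pose T := (a + b) / (p + q).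
have A0 : 0 <= A by rewrite divr_ge0//; lra.
have B0 : 0 <= B by rewrite divr_ge0//; lra.
have T0 : 0 <= T by rewrite divr_ge0//; lra.
(* A weight is positive only if the complements of the other two are. *)
have Ha : a * (ln B + ln T - ln (a / p)) <= p * (B * T) - a.
  by apply: weighted_ln_le => // a_gt0; split; rewrite divr_gt0//; lra.
have Hb : b * (ln A + ln T - ln (b / q)) <= q * (A * T) - b.
  by apply: weighted_ln_le => // b_gt0; split; rewrite divr_gt0//; lra.
have Ht : t * (ln A + ln B - ln (t / r)) <= r * (A * B) - t.
  by apply: weighted_ln_le => // t_gt0; split; rewrite divr_gt0//;
    move: t_gt0; rewrite /t; lra.
have -> : dgap a p + dgap b q - dgap (a + b) (p + q) =
  - (a * (ln B + ln T - ln (a / p)) + b * (ln A + ln T - ln (b / q))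
     + t * (ln A + ln B - ln (t / r))).
  by rewrite /dgap -/A -/B -/T -/t -/r /t; ring.
apply: (@le_trans _ _
  (- (p * (B * T) - a + (q * (A * T) - b) + (r * (A * B) - t)))); last first.
  by rewrite lerN2; lra.
rewrite le_eqVlt; apply/orP; left; apply/eqP.
by rewrite /A /B /T /t /r; field; rewrite !gt_eqF.
Qed.

Lemma dgap_subadd a b p q : 0 <= a -> 0 <= b -> a + b <= 1 ->
  0 < p -> 0 < q -> p + q < 1 -> dgap (a + b) (p + q) <= dgap a p + dgap b q.
Proof.
move=> a0 b0 ab p0 q0 pq; rewrite -subr_ge0.
apply: le_trans (dgap_subadd_defect a0 b0 ab p0 q0 pq).
have r0 : 0 <= 1 - (p + q) by lra.
have := ltW p0; have := ltW q0 => q0' p0'.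
apply: divr_ge0; first by rewrite !addr_ge0// mulr_ge0 ?sqr_ge0// mulr_ge0.
by rewrite !mulr_ge0//; lra.
Qed.

Lemma dgap_subadd_lt a b p q : 0 <= a -> 0 <= b -> a + b <= 1 ->
    0 < p -> 0 < q -> p + q < 1 -> a != p ->
  dgap (a + b) (p + q) < dgap a p + dgap b q.
Proof.
move=> a0 b0 ab p0 q0 pq ap; rewrite -subr_gt0.
apply: lt_le_trans (dgap_subadd_defect a0 b0 ab p0 q0 pq).
have r0 : 0 < 1 - (p + q) by lra.
have d0 : 0 < (a - p) ^+ 2 by rewrite exprn_even_gt0//= subr_eq0.
have := ltW p0; have := ltW q0; have := ltW r0 => r0' q0' p0'.
apply: divr_gt0; last by rewrite !mulr_gt0//; lra.
rewrite -addrA ltr_pwDl//; first by rewrite mulr_gt0// mulr_gt0.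
by rewrite addr_ge0// mulr_ge0 ?sqr_ge0// mulr_ge0.
Qed.

Lemma dgap_sum (I : Type) (l : seq I) (P : pred I) (x s : I -> R) :
    (forall i, 0 <= x i) -> (forall i, 0 < s i) ->
    \sum_(i <- l | P i) x i <= 1 -> \sum_(i <- l | P i) s i < 1 ->
  dgap (\sum_(i <- l | P i) x i) (\sum_(i <- l | P i) s i)
    <= \sum_(i <- l | P i) dgap (x i) (s i).
Proof.
move=> x0 s0; rewrite -!(big_filter l P); elim: (filter P l) => {l P} [|i l IHl].
  by rewrite !big_nil dgap00.
rewrite !big_cons => xl sl.
(* The two-term inequality needs positive second arguments, so the sum over an
   empty tail is set apart. *)
case: l => [|j l] in IHl xl sl *; first by rewrite !big_nil !addr0.
set l' := j :: l in IHl xl sl *.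
have X0 : 0 <= \sum_(k <- l') x k by rewrite sumr_ge0.
have S0 : 0 < \sum_(k <- l') s k.
  by rewrite big_cons ltr_pwDl// sumr_ge0// => k _; exact: ltW.
have := x0 i; have := s0 i => si xi.
apply: le_trans (dgap_subadd xi X0 xl si S0 sl) _.
by rewrite lerD2l IHl//; lra.
Qed.

End DivergenceGap.

(** * Comparing two points of the simplex *)

Section Simplex.
Variables (R : realType) (n : nat).
Implicit Types (x s c : 'rV[R]_n).

Lemma dgap_sum_refl s : (forall i, 0 < s 0 i < 1) ->
  \sum_i dgap (s 0 i) (s 0 i) = 0.
Proof. by move=> s01; rewrite big1// => i _; rewrite dgap_refl. Qed.

(** All indices other than [i] and [j] merge into a single one, of mass
    [1 - (x i + x j)], whose gap is the opposite of the gap of the merged pair. *)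
Lemma dgap_sum_defect x s (i j : 'I_n) :
    simplex R n x -> int_simplex R n s -> j != i ->
  dgap (x 0 i) (s 0 i) + dgap (x 0 j) (s 0 j)
    - dgap (x 0 i + x 0 j) (s 0 i + s 0 j)
  <= \sum_k dgap (x 0 k) (s 0 k).
Proof.
move=> [x0 x1] [s0 s1] ji.
have split2 (F : 'I_n -> R) : \sum_k F k =
    F i + F j + \sum_(k | (k != i) && (k != j)) F k.
  by rewrite (bigD1 i)//= (bigD1 j)//= addrA.
move: x1 s1; rewrite !split2 => x1 s1; rewrite lerD2l.
rewrite -dgap_compl.
have -> : 1 - (x 0 i + x 0 j) = \sum_(k | (k != i) && (k != j)) x 0 k by lra.
have -> : 1 - (s 0 i + s 0 j) = \sum_(k | (k != i) && (k != j)) s 0 k by lra.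
have xi := x0 i; have xj := x0 j; have si := s0 i; have sj := s0 j.
by apply: (dgap_sum x0 s0); lra.
Qed.

Lemma exists_third (i j : 'I_n) : (3 <= n)%N ->
  exists2 k : 'I_n, k != i & k != j.
Proof.
move=> n3; have /card_gt0P[k] : (0 < #|[predC [:: i; j]]|)%N.
  have := cardC (mem [:: i; j]); rewrite card_ord => cardE.
  by rewrite -(ltn_add2l #|[:: i; j]|) addn0 cardE (leq_ltn_trans (card_size _)).
by rewrite !inE negb_or => /andP[]; exists k.
Qed.

Lemma int_simplex_pair_lt1 s (i j : 'I_n) : (3 <= n)%N ->
  int_simplex R n s -> j != i -> s 0 i + s 0 j < 1.
Proof.
move=> n3 [s0 <-] ji.
have [k ki kj] := exists_third i j n3.
rewrite (bigD1 i)//= (bigD1 j)//= (bigD1 k) ?ki//= !addrA -addrA ltrDl.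
by rewrite ltr_pwDl// sumr_ge0// => l _; exact: ltW.
Qed.

Lemma dgap_sum_eq0 x s : (3 <= n)%N ->
    simplex R n x -> int_simplex R n s ->
  \sum_k dgap (x 0 k) (s 0 k) <= 0 -> x = s.
Proof.
move=> n3 Dx Ds sum_le0; apply/rowP => i; apply/eqP/negPn/negP => xsi.
have [j ji _] := exists_third i i n3.
have [[x0 x1] [s0 _]] := (Dx, Ds).
have xij : x 0 i + x 0 j <= 1.
  by rewrite -x1 (bigD1 i)//= (bigD1 j)//= addrA lerDl sumr_ge0.
have := dgap_subadd_lt (x0 i) (x0 j) xij (s0 i) (s0 j)
  (int_simplex_pair_lt1 n3 Ds ji) xsi.
by have := dgap_sum_defect Dx Ds ji; lra.
Qed.

Lemma dgap_sum_ge0 x s : (3 <= n)%N ->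
  simplex R n x -> int_simplex R n s -> 0 <= \sum_k dgap (x 0 k) (s 0 k).
Proof.
move=> n3 Dx Ds; rewrite leNgt; apply/negP => sum_lt0.
have xs := dgap_sum_eq0 n3 Dx Ds (ltW sum_lt0); move: sum_lt0.
rewrite xs dgap_sum_refl ?ltxx// => i; rewrite (Ds.1 i)/=.
have [j ji _] := exists_third i i n3.
by have := int_simplex_pair_lt1 n3 Ds ji; have := Ds.1 j; lra.
Qed.

(** * The fixed point and the objective *)

Lemma simplex_not_vertex_lt1 x (i : 'I_n) :
  (simplex R n `\` vertices R n) x -> x 0 i < 1.
Proof.
move=> [[x0 x1] vx]; rewrite ltNge; apply/negP => xi; apply: vx.
have : \sum_(j | j != i) x 0 j <= 0.
  by move: x1; rewrite (bigD1 i)//=; lra.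
rewrite le_eqVlt ltNge sumr_ge0// orbF => /eqP rest0.
exists i => //; apply/rowP => j; rewrite mxE eqxx /=.
have [->|ji] := eqVneq j i.
  by move: x1; rewrite (bigD1 i)//= rest0 addr0.
have : \sum_(j | j != i) x 0 j == 0 by rewrite rest0.
by rewrite psumr_eq0// => /allP/(_ j (mem_index_enum j))/implyP/(_ ji)/eqP ->.
Qed.

Lemma fixed_point_proportional c s : int_simplex R n c ->
    non_autocratic_fixed_point c s ->
  exists2 Y : R, 0 < Y & forall i, 0 < s 0 i /\ c 0 i = Y * (s 0 i * (1 - s 0 i)).
Proof.
move=> [c0 c1] [Ds]; rewrite /DF_map ifF; last first.
  by apply/negP; rewrite inE => vs; case: Ds.
set y := oslash _ _ => sE.
have s_lt1 i : 0 < 1 - s 0 i by rewrite subr_gt0 simplex_not_vertex_lt1.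
have yE i : y 0 i = c 0 i / (1 - s 0 i) by rewrite !mxE.
have y0 i : 0 < y 0 i by rewrite yE divr_gt0.
have sy0 : 0 <= \sum_i y 0 i by rewrite sumr_ge0// => i _; exact: ltW.
have Y0 : 0 < \sum_i y 0 i.
  rewrite lt_def sy0 andbT; apply/eqP => Y0.
  have : s = 0 by rewrite -sE Y0 invr0 scale0r.
  move=> s_eq0; have := Ds.1.2; rewrite s_eq0 big1 => [|i _]; last by rewrite mxE.
  by move/eqP; rewrite eq_sym oner_eq0.
exists (\sum_i y 0 i) => // i.
have siE : s 0 i = (\sum_i y 0 i)^-1 * y 0 i by rewrite -{1}sE mxE.
split; first by rewrite siE mulr_gt0 ?invr_gt0.
by rewrite mulrA {1}siE mulrA divff ?gt_eqF// mul1r yE divfK// gt_eqF.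
Qed.

(** The factor [x i] of [ln (c i)] and the factor [1 - x i] of [ln (1 - s i)]
    combine so that the only terms left outside the gap are [x i * ln Y], which
    add up to [ln Y], and [ln (1 - s i)]. *)
Lemma objective_as_divergence_gap c s (Y : R) x : 0 < Y ->
    (forall i, 0 < s 0 i < 1) ->
    (forall i, c 0 i = Y * (s 0 i * (1 - s 0 i))) ->
    simplex R n x ->
  KL x c + entropy (all_ones R n - x)
  = \sum_i dgap (x 0 i) (s 0 i) - (ln Y + \sum_i ln (1 - s 0 i)).
Proof.
move=> Y0 s01 cE [x0 x1].
have lnM_or0 (u v : R) : 0 <= u -> 0 < v -> u * ln (u / v) = u * ln u - u * ln v.
  rewrite le_eqVlt => /predU1P[<-|u0] v0; first by rewrite !mul0r subrr.
  by rewrite ln_div ?posrE// mulrBr.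
have -> : ln Y = \sum_i x 0 i * ln Y by rewrite -mulr_suml x1 mul1r.
rewrite /KL /entropy -big_split -!sumrB /=.
apply: eq_bigr => i _; have /andP[si0 si1] := s01 i.
have si1' : 0 < 1 - s 0 i by rewrite subr_gt0.
have xi1 : 0 <= 1 - x 0 i.
  by rewrite subr_ge0 -x1 (bigD1 i)//= lerDl sumr_ge0.
rewrite !mxE /dgap !lnM_or0 ?cE ?mulr_gt0// !lnM ?posrE ?mulr_gt0//.
by ring.
Qed.

End Simplex.

Lemma argmin_affine (R : realType) (T : Type) (D : set T) (f g : T -> R) (k l : R) :
  0 < k -> (forall x, g x = k * (f x + l)) -> argmin D g = argmin D f.
Proof.
move=> k0 gE; rewrite /argmin; apply/seteqP; split=> x [Dx xmin]; split=> // y Dy.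
  by have := xmin y Dy; rewrite !gE ler_pM2l// lerD2r.
by rewrite !gE ler_pM2l// lerD2r xmin.
Qed.

Theorem theorem1 (R : realType) (n : nat) (C : 'M[R]_n) (c xs : 'rV[R]_n) (h : R)
    (hn : (3 <= n)%N)
    (hCstoch : row_stochastic C)
    (hCdiag : zero_diagonal C)
    (hCirr : irreducible C)
    (hCstar : ~ star_topology (digraph C))
    (hc : stochastic_PF_left_eigenvector C c)
    (hxs : non_autocratic_fixed_point c xs)
    (hh : 0 < h) :
  [set xs] = argmin (simplex R n `\` vertices R n) (DF_potential h c)
  /\ argmin (simplex R n `\` vertices R n) (DF_potential h c)
     = argmin (simplex R n `\` vertices R n)
         (fun x => KL x c + entropy (all_ones R n - x)).
Proof.
have same_argmin : argmin (simplex R n `\` vertices R n) (DF_potential h c)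
     = argmin (simplex R n `\` vertices R n)
         (fun x => KL x c + entropy (all_ones R n - x)).
  apply: (@argmin_affine _ _ _ _ _ h^-1 (n%:R - 2)) => [|x].
    by rewrite invr_gt0.
  by rewrite /DF_potential addrA.
split=> //; rewrite same_argmin {same_argmin}.
have [Y Y0 sc] := fixed_point_proportional hc.1 hxs.
have Dxs := hxs.1.
have s01 i : 0 < xs 0 i < 1 by rewrite (sc i).1 simplex_not_vertex_lt1.
have Ixs : int_simplex R n xs by split=> [i|]; [exact: (sc i).1|exact: Dxs.1.2].
have objE x := objective_as_divergence_gap (x := x) Y0 s01 (fun i => (sc i).2).
apply/seteqP; split=> [_ ->|x [Dx xmin]].
  split=> // y [Dy _].
  by rewrite !objE ?lerD2r ?dgap_sum_refl ?dgap_sum_ge0//; exact: Dxs.1.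
apply: (dgap_sum_eq0 hn Dx.1 Ixs).
have := xmin xs Dxs; rewrite !objE ?lerD2r ?dgap_sum_refl//; first exact: Dxs.1.
exact: Dx.1.
Qed.
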